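(* Let $(K,\nu)$ be a valued field, $\omega$ a valuation transcendental extension of $\nu$ to $K(x)$, and $\overline{\nu}$ an extension of $\nu$ to $\overline{K}$. Then there exist only finitely many simultaneous extensions of $\omega$ and $\overline{\nu}$ to $\overline{K}(x)$.
   Context: $\overline{K}$ is a fixed algebraic closure of $K$ and $K(x)\subseteq\overline{K}(x)$ are rational function fields. An extension $\omega$ of $\nu$ to $K(x)$ is value transcendental if $\dim_{\mathbb{Q}}\big((\omega K(x)/\nu K)\otimes_{\mathbb{Z}}\mathbb{Q}\big)=1$ (where $\omega K(x)$, $\nu K$ are the value groups), residue transcendental if $\mathrm{trdeg}[K(x)\omega:K\nu]=1$ (where $K(x)\omega$, $K\nu$ are the residue fields), and valuation transcendental if it is one of these. A simultaneous extension of $\omega$ and $\overline{\nu}$ is a valuation on $\overline{K}(x)$ restricting to $\omega$ on $K(x)$ and to $\overline{\nu}$ on $\overline{K}$ (valuations are counted up to equivalence). *)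

(* Defs.v *)
From HB Require Import structures.
From mathcomp Require Import all_boot all_order all_algebra.
From mathcomp Require Import boolp.

Set Implicit Arguments.
Unset Strict Implicit.
Unset Printing Implicit Defensive.
Import Order.TTheory GRing.Theory Num.Theory.
Local Open Scope ring_scope.
Local Open Scope quotient_scope.

HB.mixin Record isOrderedZmodule G of Num.POrderedZmodule G := {
  ozmod_le_total : total (<=%R : rel G);
  ozmod_leD2r : forall x y z : G, x <= y -> x + z <= y + z
}.

#[short(type="orderedZmodType")]
HB.structure Definition OrderedZmodule :=
  { G of Num.POrderedZmodule G & isOrderedZmodule G }.

HB.instance Definition _ (G : orderedZmodType) :=
  Order.POrder_isTotal.Build ring_display G (@ozmod_le_total G).

(* G extended by an infinity: option G, with None as the infinite element. *)
Section WithInfinity.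
Variable G : orderedZmodType.
Implicit Types g h : option G.

Definition oadd g h : option G :=
  if g is Some a then if h is Some b then Some (a + b) else None else None.

Definition ole g h : bool :=
  if h is Some b then if g is Some a then a <= b else false else true.

Definition omin g h : option G := if ole g h then g else h.

End WithInfinity.

(* Krull valuations of arbitrary rank. The value group of v is the whole      *)
(* ordered group in which v takes its finite values: v is onto.               *)
Record valuation (F : fieldType) := Valuation {
  value_group : orderedZmodType;
  val_fun :> F -> option value_group;
  val_eq_infty : forall x, val_fun x = None <-> x = 0;
  val_mul : forall x y, val_fun (x * y) = oadd (val_fun x) (val_fun y);
  val_add : forall x y,
    ole (omin (val_fun x) (val_fun y)) (val_fun (x + y));
  val_onto : forall g : value_group, exists x, val_fun x = Some g
}.

Section ValuationBasics.
Variables (F : fieldType) (v : valuation F).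

Lemma val0 : v 0 = None. Proof. exact/(val_eq_infty v). Qed.

Lemma val1 : v 1 = Some 0.
Proof.
have := val_mul v 1 1; rewrite mulr1; case e: (v 1) => [g|] /=.
  by case=> e2; congr Some; apply: (@addrI _ g); rewrite addr0 -e2.
by move/(val_eq_infty v 1)/eqP: e; rewrite oner_eq0.
Qed.

Lemma valV x g : v x = Some g -> v x^-1 = Some (- g).
Proof.
move=> xg; have x0 : x != 0.
  by apply/eqP => /(val_eq_infty v x); rewrite xg.
have := val_mul v x x^-1; rewrite divff // val1 xg /=.
case: (v x^-1) => //= k [] e; congr Some.
by apply: (@addrI _ g); rewrite -e subrr.
Qed.

Lemma valN x : v (- x) = v x.
Proof.
have vN1 : v (-1) = Some 0.
  have := val_mul v (-1) (-1); rewrite mulrNN mulr1 val1.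
  case: (v (-1)) => //= g [] g2; congr Some; apply: le_anti.
  have le2 (h k : value_group v) : h <= k -> h + g <= k + g.
    exact: ozmod_leD2r.
  have /orP[g0|g0] := le_total g 0; rewrite g0 ?andbT /=.
    by have := le2 _ _ g0; rewrite -g2 add0r.
  by have := le2 _ _ g0; rewrite -g2 add0r.
rewrite -mulN1r val_mul vN1; case: (v x) => //= g.
by rewrite add0r.
Qed.

End ValuationBasics.

Definition val_equiv (F : fieldType) (v w : valuation F) : Prop :=
  exists rho : {additive value_group v -> value_group w},
    [/\ bijective rho, {mono rho : g h / g <= h}
      & forall x, w x = omap rho (v x)].

(* Since value groups are abstract, "the restriction of w is v" means up to   *)
(* an order preserving embedding of the value group of v in that of w.        *)
Definition val_extends (F E : fieldType) (i : {rmorphism F -> E})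
    (v : valuation F) (w : valuation E) : Prop :=
  exists rho : {additive value_group v -> value_group w},
    {mono rho : g h / g <= h} /\ forall x, w (i x) = omap rho (v x).

Section ValueGroupQuotient.
Variables (F E : fieldType) (i : {rmorphism F -> E}) (w : valuation E).

Definition base_values : {pred value_group w} :=
  fun g => `[< exists x : F, w (i x) = Some g >].

Fact base_values_zmod_closed : zmod_closed base_values.
Proof.
split; first by apply/asboolP; exists 1; rewrite rmorph1 val1.
move=> g h /asboolP[x xg] /asboolP[y yh]; apply/asboolP; exists (x / y).
by rewrite rmorphM val_mul xg fmorphV (valV yh).
Qed.

HB.instance Definition _ :=
  GRing.isZmodClosed.Build (value_group w) base_values base_values_zmod_closed.

(* wE / wF, the value group wF of F being identified with its image in wE *)
Definition value_group_quotient : zmodType := Quotient.quot base_values.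

End ValueGroupQuotient.

Definition biadditive (A B W : zmodType) (f : A -> B -> W) : Prop :=
  (forall a, zmod_morphism (f a)) /\ (forall b, zmod_morphism (f^~ b)).

(* V with t is the tensor product over Z of A and rat, as a rational vector   *)
(* space: t is universal among the biadditive maps, rat acts on the right     *)
(* factor.                                                                    *)
Definition is_tensor_rat (A : zmodType) (V : lmodType rat)
    (t : A -> rat -> V) : Prop :=
  [/\ biadditive t,
      forall a r q, t a (r * q) = r *: t a q
    & forall (W : zmodType) (f : A -> rat -> W), biadditive f ->
      exists g : {additive V -> W}, (forall a q, g (t a q) = f a q) /\
        forall h : {additive V -> W}, (forall a q, h (t a q) = f a q) ->
          h =1 g].

Definition dim_tensor_rat (A : zmodType) (n : nat) : Prop :=
  exists (V : lmodType rat) (t : A -> rat -> V),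
    is_tensor_rat t /\ inhabited (Vector.axiom n V).

Section ResidueField.
Variables (F : fieldType) (v : valuation F).

Definition valuation_ring_pred : {pred F} := fun x => ole (Some 0) (v x).

Fact valuation_ring_subring_closed : subring_closed valuation_ring_pred.
Proof.
split; rewrite /valuation_ring_pred.
- by rewrite unfold_in val1 /= lexx.
- move=> x y; rewrite !unfold_in => x0 y0.
  have := val_add v x (- y); rewrite valN /omin.
  case: ifP => _; case: (v (x - y)) => //= g.
    by case: (v x) x0 => //= h; exact: le_trans.
  by case: (v y) y0 => //= h; exact: le_trans.
- move=> x y; rewrite !unfold_in val_mul.
  case: (v x) (v y) => [g|] [h|] //= g0 h0.
  by apply: le_trans h0 _; rewrite -[leLHS]add0r ozmod_leD2r.
Qed.

HB.instance Definition _ :=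
  GRing.isSubringClosed.Build F valuation_ring_pred
    valuation_ring_subring_closed.

Record valuation_ring := ValuationRing {
  valring_val :> F;
  valring_valP : valring_val \in valuation_ring_pred
}.
HB.instance Definition _ := [isSub for valring_val].
HB.instance Definition _ := [Choice of valuation_ring by <:].
HB.instance Definition _ := [SubChoice_isSubComNzRing of valuation_ring by <:].

Definition maximal_ideal : {pred valuation_ring} :=
  fun x => ~~ ole (v (val x)) (Some 0).

Fact maximal_ideal_idealr_closed : idealr_closed maximal_ideal.
Proof.
split; rewrite /maximal_ideal.
- by rewrite unfold_in /= val0.
- by rewrite unfold_in /= val1 /= lexx.
- move=> a x y; rewrite !unfold_in /=; move: (valring_valP a).
  rewrite unfold_in /valuation_ring_pred => a0 x0 y0.
  have ax0 : ~~ ole (v (val a * val x)) (Some 0).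
    rewrite val_mul; case: (v (val a)) (v (val x)) a0 x0 => [g|] [h|] //= g0.
    rewrite -!ltNge => h0; apply: lt_le_trans h0 _.
    by rewrite -[leLHS]add0r ozmod_leD2r.
  have := val_add v (val a * val x) (val y); rewrite /omin.
  case: ifP => _; case: (v (_ + _)) => //= g.
    case: (v (val a * val x)) ax0 => //= h; rewrite -!ltNge.
    exact: lt_le_trans.
  case: (v (val y)) y0 => //= h; rewrite -!ltNge; exact: lt_le_trans.
Qed.

HB.instance Definition _ :=
  isIdealr.Build valuation_ring maximal_ideal maximal_ideal_idealr_closed.

Definition residue_field := {ideal_quot maximal_ideal}.
HB.instance Definition _ := GRing.ComNzRing.on residue_field.

(* the class of x when x is in the valuation ring, 0 otherwise *)
Definition residue (x : F) : residue_field :=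
  \pi_residue_field (insubd (0 : valuation_ring) x).

Definition residue_inv (a : residue_field) : residue_field :=
  residue (val (repr a))^-1.

Lemma residue_eq0 (x : valuation_ring) :
  (\pi_residue_field x == 0) = (x \in maximal_ideal).
Proof.
by rewrite -[x in RHS]subr0 Quotient.idealrBE -(rmorph0 \pi_residue_field).
Qed.

Fact residue_mulVf a : a != 0 -> residue_inv a * a = 1.
Proof.
rewrite -{1}[a]reprK residue_eq0 {1}/in_mem /= /maximal_ideal negbK => x0.
have vx : v (val (repr a)) = Some 0.
  have := valring_valP (repr a); rewrite unfold_in /valuation_ring_pred /=.
  case: (v _) x0 => //= g g0 g0'; congr Some.
  by apply: le_anti; rewrite g0 g0'.
have xU : (val (repr a))^-1 \in valuation_ring_pred.
  by rewrite unfold_in /valuation_ring_pred (valV vx) oppr0 /= lexx.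
rewrite -[a in _ * a]reprK /residue_inv /residue -rmorphM.
rewrite -(rmorph1 \pi_residue_field); congr (\pi _); apply: val_inj => /=.
rewrite insubdK // mulVf //; apply/eqP => e.
by have := vx; rewrite [X in v X]e val0.
Qed.

Fact residue_inv0 : residue_inv 0 = 0.
Proof.
rewrite /residue_inv /residue; set x := repr 0.
have: x \in maximal_ideal by rewrite -residue_eq0 reprK.
rewrite unfold_in /maximal_ideal => x0.
suff -> : insubd (0 : valuation_ring) (val x)^-1 = 0 by rewrite rmorph0.
have [->|x_neq0] := eqVneq x 0.
  by apply: val_inj; rewrite insubdK ?invr0 // rpred0.
rewrite /insubd insubF //; apply/negbTE/negP.
rewrite unfold_in /valuation_ring_pred.
case e: (v (val x)) x0 => [g|] /=; last first.
  by move/(val_eq_infty v): e x_neq0 => e; rewrite -val_eqE /= e eqxx.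
rewrite (valV e) /= => /negP g0 g1; apply: g0.
by have := @ozmod_leD2r _ _ _ g g1; rewrite add0r addNr.
Qed.

HB.instance Definition _ :=
  GRing.ComNzRing_isField.Build residue_field residue_mulVf residue_inv0.

End ResidueField.

(* The map Fv -> Ew induced by i; it is a field embedding if w extends v. *)
Definition residue_map (F E : fieldType) (i : F -> E) (v : valuation F)
    (w : valuation E) (a : residue_field v) : residue_field w :=
  residue w (i (val (repr a))).

(* The extension of an injective ring morphism f to the field of fractions.   *)
Definition fraction_lift (R : idomainType) (F : fieldType) (f : R -> F)
    (q : {fraction R}) : F :=
  f \n_(repr q) / f \d_(repr q).

Section FractionLift.
Variables (R : idomainType) (F : fieldType) (f : {rmorphism R -> F}).
Hypothesis f_inj : injective f.

Let fd0 (x : {ratio R}) : f \d_x != 0.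
Proof. by rewrite (raddf_eq0 _ f_inj) denom_ratioP. Qed.

Lemma fraction_lift_pi (x : {ratio R}) :
  fraction_lift f (\pi_{fraction R} x) = f \n_x / f \d_x.
Proof.
apply/eqP; rewrite /fraction_lift eqr_div ?fd0 // -!rmorphM.
by rewrite FracField.equivf_l mulrC.
Qed.

Lemma fraction_lift_tofrac (r : R) : fraction_lift f (FracField.tofrac r) = f r.
Proof.
unlock FracField.tofrac; rewrite fraction_lift_pi !numden_Ratio ?oner_eq0 //.
by rewrite rmorph1 divr1.
Qed.

Lemma fraction_lift_zmod_morphism : zmod_morphism (fraction_lift f).
Proof.
elim/quotW => x; elim/quotW => y.
have -> : \pi_{fraction R} x - \pi_{fraction R} y =
    \pi_{fraction R} (FracField.addf x (FracField.oppf y)).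
  by rewrite FracField.pi_add FracField.pi_opp.
rewrite !fraction_lift_pi /FracField.addf /FracField.oppf.
rewrite !numden_Ratio ?mulf_neq0 ?denom_ratioP // -mulNr addf_div ?fd0 //.
by rewrite rmorphD !rmorphM rmorphN.
Qed.

Lemma fraction_lift_monoid_morphism : monoid_morphism (fraction_lift f).
Proof.
split; first by rewrite -[1]/(FracField.tofrac 1) fraction_lift_tofrac rmorph1.
elim/quotW => x; elim/quotW => y.
have -> : \pi_{fraction R} x * \pi_{fraction R} y =
    \pi_{fraction R} (FracField.mulf x y).
  by rewrite FracField.pi_mul.
rewrite !fraction_lift_pi /FracField.mulf.
by rewrite !numden_Ratio ?mulf_neq0 ?denom_ratioP // !rmorphM mulf_div.
Qed.

End FractionLift.

Notation ratfun K := {fraction {poly K}}.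

Definition ratfun_const (K : fieldType) : K -> ratfun K :=
  @FracField.tofrac {poly K} \o polyC.
HB.instance Definition _ (K : fieldType) :=
  GRing.RMorphism.copy (@ratfun_const K) (@FracField.tofrac {poly K} \o polyC).

Definition ratfun_map (K L : fieldType) (i : {rmorphism K -> L}) :
    ratfun K -> ratfun L :=
  fraction_lift (@FracField.tofrac {poly L} \o map_poly i).

Section RatfunMap.
Variables (K L : fieldType) (i : {rmorphism K -> L}).

Let inj : injective (@FracField.tofrac {poly L} \o map_poly i).
Proof. by move=> p q /= /eqP; rewrite tofrac_eq => /eqP; apply: map_poly_inj. Qed.

HB.instance Definition _ :=
  GRing.isZmodMorphism.Build (ratfun K) (ratfun L) (ratfun_map i)
    (fraction_lift_zmod_morphism inj).
HB.instance Definition _ :=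
  GRing.isMonoidMorphism.Build (ratfun K) (ratfun L) (ratfun_map i)
    (fraction_lift_monoid_morphism inj).

End RatfunMap.

(* A transcendence basis of L over k (along the embedding i) has exactly one  *)
(* element t; fraction_lift (p |-> p(t)) is the isomorphism from k(T) to k(t) *)
(* when t is transcendental.                                                  *)
Definition trdeg_eq1 (k L : fieldType) (i : k -> L) : Prop :=
  exists t : L, ~ algebraicOver i t /\
    forall u : L,
      algebraicOver (fraction_lift (fun p : {poly k} => (map_poly i p).[t])) u.

Section Transcendental.
Variables (K : fieldType) (nu : valuation K) (omega : valuation (ratfun K)).

Definition value_transcendental : Prop :=
  dim_tensor_rat (value_group_quotient (@ratfun_const K) omega) 1.

Definition residue_transcendental : Prop :=
  trdeg_eq1 (@residue_map _ _ (@ratfun_const K) nu omega).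

Definition valuation_transcendental : Prop :=
  value_transcendental \/ residue_transcendental.

End Transcendental.

Definition simultaneous_extension (K L : fieldType) (i : {rmorphism K -> L})
    (omega : valuation (ratfun K)) (nubar : valuation L)
    (mu : valuation (ratfun L)) : Prop :=
  val_extends (ratfun_map i) omega mu /\ val_extends (@ratfun_const L) nubar mu.

(* Main.v *)
(* Put T = x - a with a in Kbar. If no r in Kbar satisfies mu(T - r) > mu(T),
   then mu is the Gauss valuation mu(sum c_i T^i) = min_i mu(c_i T^i): the min
   norm is trivially submultiplicative, and on the linear factors it agrees
   with mu. Otherwise T agrees up to higher order with a constant r. If this
   happened for every root a of f g, where f, g are polynomials over K, then f/g
   would agree up to higher order with a constant too. This is impossible when
   f/g has a value that is torsion free modulo nu K, or a residue transcendental
   over K nu. Hence for one fixed h = f g, every simultaneous extension mu is the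
   Gauss valuation attached to some root a of h. The value of h is then
   mu(C) + n mu(T), where n >= 1 and C depend only on a and on the set of roots z
   with mu(T) <= mu(a - z); so omega and nubar determine n mu(T), and thus mu up
   to equivalence, once a and this set are given. *)
Require Import Defs.
From HB Require Import structures.
From mathcomp Require Import all_boot all_order all_algebra.
From mathcomp Require Import boolp ring.

Set Implicit Arguments.
Unset Strict Implicit.
Unset Printing Implicit Defensive.
Import Order.TTheory GRing.Theory Num.Theory.
Local Open Scope ring_scope.

(** * Comparing elements by their values *)

(** Comparing field elements instead of values lets different valuations on one field be compared
    without relating their abstract value groups. The negation [~~ vle v x y] says that x has
    strictly greater value than y. *)
Definition vle (F : fieldType) (v : valuation F) (x y : F) : bool :=
  ole (v x) (v y).

Section ValuationOrder.
Variables (F : fieldType) (v : valuation F).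
Implicit Types x y z t : F.

Lemma ozmod_lerD2r (G : orderedZmodType) (z x y : G) :
  (x + z <= y + z) = (x <= y).
Proof.
apply/idP/idP => [|/ozmod_leD2r //].
by move/(@ozmod_leD2r _ _ _ (- z)); rewrite !addrK.
Qed.

Lemma vle_refl x : vle v x x.
Proof. by rewrite /vle; case: (v x) => //= g; rewrite lexx. Qed.
Hint Resolve vle_refl : core.

Lemma vle_trans y x z : vle v x y -> vle v y z -> vle v x z.
Proof.
by rewrite /vle; case: (v x) (v y) (v z) => [a|] [b|] [c|] //=; apply: le_trans.
Qed.

Lemma vle_total x y : vle v x y || vle v y x.
Proof.
by rewrite /vle; case: (v x) (v y) => [a|] [b|] //=; apply: le_total.
Qed.

Lemma vle_lt x y : ~~ vle v x y -> vle v y x.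
Proof. by have := vle_total x y; case: (vle v x y). Qed.

Lemma vle0 x : vle v x 0.
Proof. by rewrite /vle val0. Qed.

Lemma vle0x x : vle v 0 x = (x == 0).
Proof.
rewrite /vle val0; case e: (v x) => [g|] /=; last first.
  by move/(val_eq_infty v): e ->; rewrite eqxx.
by symmetry; apply/eqP => x0; rewrite x0 val0 in e.
Qed.

Lemma val_eqP x y : reflect (v x = v y) (vle v x y && vle v y x).
Proof.
rewrite /vle; apply: (iffP andP) => [|e].
  2: by move: (vle_refl y); rewrite /vle e.
case: (v x) (v y) => [a|] [b|] [] //= ab ba.
by congr Some; apply: le_anti; rewrite ab ba.
Qed.

Lemma vle_mul2r z x y : z != 0 -> vle v (x * z) (y * z) = vle v x y.
Proof.
move=> z0; rewrite /vle !val_mul; case e: (v z) => [c|]; last first.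
  by move/(val_eq_infty v): e z0 => ->; rewrite eqxx.
by case: (v x) (v y) => [a|] [b|] //=; rewrite ozmod_lerD2r.
Qed.

Lemma vle_mul2l z x y : z != 0 -> vle v (z * x) (z * y) = vle v x y.
Proof. by rewrite !(mulrC z); apply: vle_mul2r. Qed.

Lemma vle_div x y z t : y != 0 -> t != 0 ->
  vle v (x / y) (z / t) = vle v (x * t) (z * y).
Proof.
move=> y0 t0; rewrite -(vle_mul2r _ _ (mulf_neq0 y0 t0)).
by congr (vle _ _ _); field; rewrite ?y0 ?t0.
Qed.

Lemma vle_mul x y z t : vle v x y -> vle v z t -> vle v (x * z) (y * t).
Proof.
have [->|y0] := eqVneq y 0; first by move=> *; rewrite mul0r vle0.
have [->|z0 xy zt] := eqVneq z 0.
  by rewrite vle0x => _ /eqP->; rewrite !mulr0.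
by apply: (@vle_trans (y * z)); rewrite ?vle_mul2r ?vle_mul2l.
Qed.

Lemma vle_mul_lt x y z t : ~~ vle v x y -> vle v t z -> t != 0 ->
  ~~ vle v (x * z) (y * t).
Proof.
move=> xy tz t0; apply: contra xy => xy; rewrite -(vle_mul2r _ _ t0).
exact: vle_trans (vle_mul (vle_refl x) tz) xy.
Qed.

Lemma vleXn x y n : vle v x y -> vle v (x ^+ n) (y ^+ n).
Proof. by move=> xy; elim: n => // n IH; rewrite !exprS vle_mul. Qed.

(** Strict inequalities survive powers. Comparisons can therefore be raised to a power that brings
    them down to a subfield where they are known. *)
Lemma vle_exp2 x y n : (0 < n)%N -> vle v (x ^+ n) (y ^+ n) = vle v x y.
Proof.
case: n => // n _; apply/idP/idP; last exact: vleXn.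
apply: contraLR => xy; rewrite !exprS.
have y0 : y != 0 by apply: contra xy => /eqP->; apply: vle0.
by apply: vle_mul_lt => //; rewrite ?expf_neq0 // vleXn // vle_lt.
Qed.

Lemma vleD x y z : vle v z x -> vle v z y -> vle v z (x + y).
Proof.
rewrite /vle => zx zy; have := val_add v x y; rewrite /omin.
by case: ifP => _; case: (v z) (v x) (v y) (v (x + y)) zx zy
   => [a|] [b|] [c|] [d|] //=; move=> H1 H2; apply: le_trans.
Qed.

Lemma vleN x y : vle v x (- y) = vle v x y.
Proof. by rewrite /vle valN. Qed.

Lemma vleNl x y : vle v (- x) y = vle v x y.
Proof. by rewrite /vle valN. Qed.

Lemma vleB x y z : vle v z x -> vle v z y -> vle v z (x - y).
Proof. by move=> zx zy; rewrite vleD ?vleN. Qed.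

Lemma vle_sum (I : Type) (r : seq I) (P : pred I) (f : I -> F) z :
  (forall i, P i -> vle v z (f i)) -> vle v z (\sum_(i <- r | P i) f i).
Proof.
by move=> H; elim/big_ind: _ => [|x y|] //; [rewrite vle0|apply: vleD].
Qed.

Lemma val_exp_eq x y n : v x = v y -> v (x ^+ n) = v (y ^+ n).
Proof. by move=> e; elim: n => // n IH; rewrite !exprS !val_mul e IH. Qed.

Lemma val_mul_eq x y z t : v x = v y -> v z = v t -> v (x * z) = v (y * t).
Proof. by move=> e e'; rewrite !val_mul e e'. Qed.

Lemma val_eq_sub x y : ~~ vle v (x - y) x -> v x = v y.
Proof.
move=> H; apply/val_eqP; apply/andP; split.
  by rewrite -[y](subKr x) vleB // vle_lt.
apply: contraR H => yx; case/orP: (vle_total y (x - y)) => c.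
  by case/negP: yx; rewrite -[x](subrKC y) vleD.
by rewrite -[X in vle _ _ X](subrKC y) vleD.
Qed.

Lemma vltD x y z : ~~ vle v x z -> ~~ vle v y z -> ~~ vle v (x + y) z.
Proof.
move=> xz yz; case/orP: (vle_total x y) => xy.
  by apply: contra xz; apply: vle_trans; apply: vleD.
by apply: contra yz; apply: vle_trans; apply: vleD.
Qed.

Lemma val_inv_eq x y : v x = v y -> v x^-1 = v y^-1.
Proof.
case e: (v x) => [g|] e'; first by rewrite (valV e) (valV (esym e')).
by rewrite (iffLR (val_eq_infty v x) e) (iffLR (val_eq_infty v y) (esym e')).
Qed.

Lemma exists_vle_min (f : nat -> F) n :
  exists2 i, (i <= n)%N & forall j, (j <= n)%N -> vle v (f i) (f j).
Proof.
elim: n => [|n [i lein H]].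
  by exists 0%N => // j; rewrite leqn0 => /eqP->.
case/orP: (vle_total (f i) (f n.+1)) => c; [exists i|exists n.+1] => //.
- exact: leqW.
- by move=> j; rewrite leq_eqVlt => /predU1P[->|/H].
- move=> j; rewrite leq_eqVlt => /predU1P[->//|/H]; exact: vle_trans.
Qed.

End ValuationOrder.
#[export] Hint Resolve vle_refl : core.

(** * Extensions and equivalence of valuations *)

Lemma vle_ext (F E : fieldType) (i : {rmorphism F -> E}) v w :
  val_extends i v w -> forall x y, vle w (i x) (i y) = vle v x y.
Proof.
case=> rho [mono ext] x y; rewrite /vle !ext.
by case: (v x) (v y) => [a|] [b|] //=; apply: mono.
Qed.

Lemma val_ext_eq (F E : fieldType) (i : {rmorphism F -> E}) v w :
  val_extends i v w -> forall x y, v x = v y -> w (i x) = w (i y).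
Proof. by move=> ext x y /val_eqP e; apply/val_eqP; rewrite !(vle_ext ext). Qed.

Section ValueGroupMap.
Variables (F : fieldType) (v w : valuation F).
Hypothesis vw : forall x y, vle v x y = vle w x y.

(** The value of x under v is sent to its value under w, for a chosen x. The default 0 is never
    reached, as x has a finite value and so is nonzero. *)
Definition value_group_map (g : value_group v) : value_group w :=
  odflt 0 (w (projT1 (cid (val_onto g)))).

Let eq_vw x y : v x = v y -> w x = w y.
Proof. by move=> /val_eqP e; apply/val_eqP; rewrite -!vw. Qed.

Lemma value_group_mapE x : w x = omap value_group_map (v x).
Proof.
case e: (v x) => [g|] /=; last first.
  by move/(val_eq_infty v): e => ->; rewrite val0.
rewrite /value_group_map; case: cid => y /= yg.
have -> : w y = w x by apply: eq_vw; rewrite e yg.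
case e': (w x) => [//|]; move/(val_eq_infty w): e' => x0.
by rewrite x0 val0 in e.
Qed.

Fact value_group_map_zmod_morphism : zmod_morphism value_group_map.
Proof.
move=> g h; have [x xg] := val_onto g; have [y yh] := val_onto h.
have := value_group_mapE (x / y); have := value_group_mapE x.
have := value_group_mapE y; rewrite !val_mul xg yh (valV yh) /= => wy ->.
by rewrite (valV wy) /= => -[].
Qed.

HB.instance Definition _ :=
  GRing.isZmodMorphism.Build _ _ value_group_map value_group_map_zmod_morphism.

Lemma value_group_map_mono : {mono value_group_map : g h / g <= h}.
Proof.
move=> g h; have [x xg] := val_onto g; have [y yh] := val_onto h.
by have := vw x y; rewrite /vle !value_group_mapE xg yh /=.
Qed.

(** A valuation is determined up to equivalence by its preorder, since it maps onto its value
    group. *)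
Lemma vle_val_equiv : val_equiv v w.
Proof.
exists value_group_map; split; last exact: value_group_mapE.
- exists (fun h => odflt 0 (v (projT1 (cid (val_onto h))))) => [g|h].
    case: cid => y /=; rewrite value_group_mapE.
    case: (v y) => //= g' [] e; apply: le_anti.
    by rewrite -!value_group_map_mono e lexx.
  case: cid => y /=; rewrite value_group_mapE.
  by case: (v y) => //= g' [].
- exact: value_group_map_mono.
Qed.

End ValueGroupMap.

(** * Rational functions as fractions of polynomials *)

Local Notation "x %:F" := (FracField.tofrac x).

Lemma ratfunP (K : fieldType) (u : ratfun K) :
  exists p q : {poly K}, q != 0 /\ u = p%:F / q%:F.
Proof.
elim/quotW: u => y; exists \n_y, \d_y; split; first exact: denom_ratioP.
have d0 : (\d_y)%:F != 0 by rewrite tofrac_eq0 denom_ratioP.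
apply: (canRL (mulfK d0)).
unlock FracField.tofrac; rewrite -[LHS]FracField.pi_mul /FracField.mulf.
apply/eqmodP => /=; rewrite FracField.equivfE.
rewrite !numden_Ratio ?mulf_neq0 ?oner_eq0 ?denom_ratioP //.
by rewrite !mulr1 mulrC.
Qed.

Lemma ratfun_map_tofrac (K L : fieldType) (i : {rmorphism K -> L}) p :
  ratfun_map i p%:F = (map_poly i p)%:F.
Proof.
apply: fraction_lift_tofrac => q r /= /eqP.
by rewrite tofrac_eq => /eqP; apply: map_poly_inj.
Qed.

Lemma ratfun_map_const (K L : fieldType) (i : {rmorphism K -> L}) c :
  ratfun_map i (ratfun_const c) = ratfun_const (i c).
Proof. by rewrite /ratfun_const /= ratfun_map_tofrac map_polyC. Qed.

Lemma horner_ratfun_const (K : fieldType) (p q : {poly K}) :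
  (map_poly (@ratfun_const K) p).[q%:F] = (p \Po q)%:F.
Proof.
elim/poly_ind: p => [|p c IH].
  by rewrite rmorph0 horner0 comp_poly0 rmorph0.
rewrite rmorphD rmorphM /= map_polyX map_polyC hornerMXaddC IH comp_polyD.
by rewrite comp_polyM comp_polyX comp_polyC rmorphD rmorphM.
Qed.

(** * Gauss valuations and approximation by constants *)

Section GaussValuation.
Variables (L : closedFieldType) (E : fieldType) (c : {rmorphism L -> E}).
Variable v : valuation E.

(* The norm min_i v(p_i T^i) is trivially submultiplicative, so it suffices to
   compare it with v on the linear factors. *)
Lemma vle_horner_coef (T : E) : (forall r, vle v (T - c r) T) ->
  forall (p : {poly L}) i, vle v (map_poly c p).[T] (c p`_i * T ^+ i).
Proof.
(* As c r = T - (T - c r), the value of T - c r is at most both v(T) and v(c r). *)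
move=> HT p; have HTr r : vle v (T - c r) (c r).
  by rewrite -[c r in X in vle _ _ X](subKr T) vleB.
have [rs ->] := closed_field_poly_normal p.
have -> : (map_poly c (lead_coef p *: \prod_(z <- rs) ('X - z%:P))).[T] =
   c (lead_coef p) * (map_poly c (\prod_(z <- rs) ('X - z%:P))).[T].
  by rewrite map_polyZ hornerZ.
move=> i; rewrite coefZ rmorphM -mulrA; apply: vle_mul => //.
elim: rs i => [|r rs IH] i.
  rewrite big_nil rmorph1 hornerC coefC.
  by case: i => [|i]; rewrite ?rmorph1 ?mulr1 // rmorph0 mul0r vle0.
rewrite big_cons rmorphM rmorphB /= map_polyX map_polyC hornerM hornerXsubC.
set q := \prod_(z <- rs) _ in IH *.
rewrite [('X - _) * q]mulrBl coefB coefXM coefCM rmorphB [X in vle _ _ X]mulrBl.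
apply: vleB.
  case: i => [|i] /=; first by rewrite rmorph0 mul0r vle0.
  by rewrite exprS mulrCA; apply: vle_mul (HT r) (IH i).
by rewrite rmorphM -mulrA; apply: vle_mul (HTr r) (IH _).
Qed.

(** The element u agrees with a constant up to higher order. The strict inequality forces u to be
    nonzero, and such elements form a multiplicative group. *)
Definition const_approx (u : E) : Prop := exists e : L, ~~ vle v (u - c e) u.

Lemma const_approx_neq0 u e : ~~ vle v (u - c e) u -> (u != 0) && (c e != 0).
Proof.
move=> H; have u0 : u != 0 by apply: contra H => /eqP->; apply: vle0.
by rewrite u0; apply: contra H => /eqP->; rewrite subr0 vle_refl.
Qed.

Lemma const_approx_const e : e != 0 -> const_approx (c e).
Proof. by move=> e0; exists e; rewrite subrr vle0x fmorph_eq0. Qed.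

Lemma const_approxM u u' :
  const_approx u -> const_approx u' -> const_approx (u * u').
Proof.
move=> [e ue] [e' ue']; exists (e * e').
have /andP[u0 e0] := const_approx_neq0 ue.
have /andP[u0' e0'] := const_approx_neq0 ue'.
have := val_eq_sub ue' => /val_eqP/andP[l1 l2].
rewrite rmorphM.
(* Both summands have value above that of u u', because v(c e') = v(u'). *)
have -> : u * u' - c e * c e' = (u - c e) * c e' + (u' - c e') * u by ring.
apply: vltD; first exact: vle_mul_lt.
by rewrite [u * u']mulrC; apply: vle_mul_lt.
Qed.

Lemma const_approxV u : const_approx u -> const_approx u^-1.
Proof.
move=> [e ue]; exists e^-1; have /andP[u0 e0] := const_approx_neq0 ue.
have -> : u^-1 - c e^-1 = (u - c e) * - (u * c e)^-1.
  by rewrite fmorphV; field; rewrite u0 e0.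
(* Both sides become multiples of inverses of equal value, since v(u * c e) = v(u * u). *)
have -> : u^-1 = u * (u * u)^-1 by field.
have /(val_mul_eq (erefl (v u)))/val_inv_eq/val_eqP/andP[le1 le2] :=
  val_eq_sub ue.
by apply: vle_mul_lt; rewrite ?vleN // invr_eq0 mulf_neq0.
Qed.

Lemma const_approx_prod (I : eqType) (r : seq I) (f : I -> E) :
  {in r, forall i, const_approx (f i)} -> const_approx (\prod_(i <- r) f i).
Proof.
move=> H; rewrite big_seq.
elim/big_ind: _ => // [|x y]; last exact: const_approxM.
by rewrite -(rmorph1 c); apply: const_approx_const; apply: oner_neq0.
Qed.

End GaussValuation.

(** * Torsion in value groups *)

Lemma vlt_sum (F : fieldType) (v : valuation F) (I : Type) (r : seq I)
    (P : pred I) (f : I -> F) z : z != 0 ->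
  (forall i, P i -> ~~ vle v (f i) z) -> ~~ vle v (\sum_(i <- r | P i) f i) z.
Proof.
move=> z0 H; elim/big_ind: _ => [|x y|] //; last exact: vltD.
by rewrite vle0x.
Qed.

Lemma val_exp (F : fieldType) (v : valuation F) x g n :
  v x = Some g -> v (x ^+ n) = Some (g *+ n).
Proof.
move=> xg; elim: n => [|n IH]; first by rewrite Defs.val1.
by rewrite exprS val_mul IH xg mulrS.
Qed.

(* Two terms of a polynomial relation for e must have the same value. *)
Lemma algebraic_val_torsion (K L : fieldType) (iota : {rmorphism K -> L})
    (v : valuation L) (e : L) : e != 0 -> algebraicOver iota e ->
  exists2 m, (0 < m)%N & exists k, v (e ^+ m) = v (iota k).
Proof.
move=> e0 [p p0 /rootP].
(* Two terms of equal value in degrees i < j give the exponent j - i, with k the quotient of their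
   coefficients. *)
have quot i j (a b : K) : b != 0 -> (i < j)%N ->
    v (iota a * e ^+ i) = v (iota b * e ^+ j) ->
    exists2 m, (0 < m)%N & exists k, v (e ^+ m) = v (iota k).
  move=> b0 ij E; exists (j - i)%N; first by rewrite subn_gt0.
  exists (a / b).
  have := val_mul_eq E (erefl (v (iota b * e ^+ i)^-1)).
  rewrite -[j in X in _ = v (X * _)](subnK (ltnW ij)) exprD.
  have ib : iota b != 0 by rewrite fmorph_eq0.
  have -> : iota b * (e ^+ (j - i) * e ^+ i) / (iota b * e ^+ i) = e ^+ (j - i).
    by field; rewrite ib expf_neq0.
  move=> <-; congr (v _); rewrite fmorph_div; field.
  by rewrite ib expf_neq0.
(* The sum is padded by one zero term, so that any index up to [size p] fits in its range. *)
rewrite (horner_coef_wide _ (leq_trans (size_poly _ _) (leqnSn _))) => p_e.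
pose t i := iota p`_i * e ^+ i.
have [i0 lei0 mini0] := exists_vle_min v t (size p).
have t0 : t i0 != 0.
  apply: contraNneq p0 => ti0; have := mini0 (size p).-1 (leq_pred _).
  rewrite ti0 vle0x mulf_eq0 fmorph_eq0 expf_eq0 (negbTE e0) andbF orbF.
  by rewrite -lead_coefE lead_coef_eq0.
have pn i : t i != 0 -> p`_i != 0.
  by apply: contraNneq => pi; rewrite /t pi rmorph0 mul0r.
have i0K : (i0 < (size p).+1)%N by [].
(* Otherwise the remaining terms would sum to a value strictly above that of [t i0], but their sum
   is [- t i0]. *)
have [j jn jle] : exists2 j : 'I_(size p).+1,
    j != Ordinal i0K & vle v (t j) (t i0).
  apply: contrapT => H; move: p_e; rewrite (bigD1 (Ordinal i0K)) //=.
  rewrite coef_map /= => /eqP; rewrite addrC addr_eq0 => /eqP S.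
  have /negP : ~~ vle v (\sum_(i < (size p).+1 | i != Ordinal i0K) t i) (t i0).
    by apply: vlt_sum => // i ni; apply/negP => li; apply: H; exists i.
  case; under eq_bigr do rewrite /t -coef_map.
  by rewrite S vleNl /t vle_refl.
have tj : t j != 0 by apply: contraNneq t0 => tj; rewrite -(vle0x v) -tj.
have E : v (t i0) = v (t j) by apply/val_eqP; rewrite jle mini0 // -ltnS.
case: (ltngtP i0 j) => ij.
- exact: quot (pn _ tj) ij E.
- exact: quot (pn _ t0) ij (esym E).
- by case/eqP: jn; apply: val_inj.
Qed.

(** If n a = 0, then t a q = t (n a) (q / n) = 0. A torsion group thus has zero tensor product with
    the rationals, which is not of dimension 1. *)
Lemma dim_tensor_rat1_nontorsion (A : zmodType) : dim_tensor_rat A 1 ->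
  exists a : A, forall n, (0 < n)%N -> a *+ n != 0.
Proof.
move=> [V [t [[[tl tr] tZ univ] [[f f_lin f_bij]]]]].
apply: contrapT => tors.
have t0 a q : t a q = 0.
  have [n n0 an] : exists2 n, (0 < n)%N & a *+ n = 0.
    apply: contrapT => H; apply: tors; exists a => n n0.
    by apply: contra_notN H => /eqP an; exists n.
  pose tq := HB.pack_for {additive A -> V} (t^~ (q / n%:R))
    (GRing.isZmodMorphism.Build _ _ _ (tr (q / n%:R))).
  pose ta := HB.pack_for {additive rat -> V} (t a)
    (GRing.isZmodMorphism.Build _ _ _ (tl a)).
  have -> : q = (q / n%:R) *+ n by rewrite -mulr_natr mulfVK // pnatr_eq0 -lt0n.
  rewrite -[t a _]/(ta _) raddfMn /= -[t a _]/(tq a) -raddfMn an.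
  exact: raddf0.
(* When t vanishes, the identity and the zero map both factor t through itself, so uniqueness makes
   V trivial. *)
have [g [_ g_uniq]] := univ V t (conj tl tr).
have V0 (x : V) : x = 0.
  have := g_uniq idfun (fun a q => erefl) x.
  have := g_uniq (@GRing.null_fun V V) (fun a q => esym (t0 a q)) x.
  by rewrite /= => <- ->.
have [f' _ fK] := f_bij.
have : const_mx 1 = 0 :> 'rV[rat]_1.
  by rewrite -(fK (const_mx 1)) (V0 (f' _)) -(V0 (f' 0)) fK.
by move/matrixP/(_ ord0 ord0)/eqP; rewrite !mxE oner_eq0.
Qed.

(** The n-th power turns T into T^n, whose value is that of H / C; multiplying by C^(i+j) clears
    denominators. Monomials in T are thus compared through H, which will come from K(x). *)
Lemma vle_monomial_exp (F E : fieldType) (c : {rmorphism F -> E})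
    (v : valuation E) (T H : E) (C b b' : F) (n i j : nat) :
  C != 0 -> (0 < n)%N -> v H = v (c C * T ^+ n) ->
  vle v (c b * T ^+ i) (c b' * T ^+ j) =
  vle v (c (b ^+ n * C ^+ j) * H ^+ i) (c (b' ^+ n * C ^+ i) * H ^+ j).
Proof.
move=> C0 n0 vH; rewrite -(vle_exp2 _ _ _ n0).
have Cij : c (C ^+ (i + j)) != 0 by rewrite fmorph_eq0 expf_neq0.
rewrite -(vle_mul2r _ _ _ Cij).
have conv b1 i1 j1 : v (c (b1 ^+ n * C ^+ j1) * H ^+ i1) =
    v ((c b1 * T ^+ i1) ^+ n * c (C ^+ (i1 + j1))).
  rewrite (val_mul_eq (erefl _) (val_exp_eq i1 vH)); congr (v _).
  rewrite exprD !rmorphM !rmorphXn !exprMn -!exprM [(n * _)%N]mulnC.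
  by ring.
by rewrite /vle !conv [(j + i)%N]addnC.
Qed.

(** * Residue maps and algebraic residues *)

Section ResidueMap.
Variables (F E : fieldType) (c : {rmorphism F -> E}).
Variables (v : valuation F) (w : valuation E).
Hypothesis c_ext : val_extends c v w.

Lemma vle1_valring (F' : fieldType) (v' : valuation F') x :
  vle v' 1 x = (x \in valuation_ring_pred v').
Proof. by rewrite /vle Defs.val1. Qed.

Lemma maximal_idealE (F' : fieldType) (v' : valuation F') x :
  (x \in maximal_ideal (v := v')) = ~~ vle v' (val x) 1.
Proof. by rewrite /vle Defs.val1. Qed.

Lemma residue0 (F' : fieldType) (v' : valuation F') : residue v' 0 = 0.
Proof.
apply/eqP; rewrite /residue residue_eq0 maximal_idealE insubdK ?rpred0 //.
by rewrite vle0x oner_eq0.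
Qed.

(** The representative chosen by [repr] differs from k by an element of the maximal ideal, which c
    maps into the maximal ideal of w. *)
Lemma residue_map_residue k :
  vle v 1 k -> residue_map c w (residue v k) = residue w (c k).
Proof.
move=> k1; rewrite /residue_map /residue; set X := insubd _ k.
have kX : val X = k by rewrite insubdK // -vle1_valring.
have: repr (\pi_(residue_field v)%qT X) - X \in maximal_ideal (v := v).
  by rewrite Quotient.idealrBE reprK.
set r := repr _ => rX; apply/eqP; rewrite -Quotient.idealrBE.
have cr (x : valuation_ring v) : c (val x) \in valuation_ring_pred w.
  rewrite -vle1_valring -(rmorph1 c) (vle_ext c_ext) vle1_valring.
  exact: valring_valP.
rewrite maximal_idealE rmorphB /= !insubdK -?kX ?cr //.
rewrite -rmorphB -(rmorph1 c) (vle_ext c_ext).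
by move: rX; rewrite maximal_idealE rmorphB.
Qed.

(** The unit coefficient p_i keeps the reduction of p nonzero, and p(u) has positive value, so this
    reduction vanishes at the residue of u. *)
Lemma algebraicOver_residue_map (p : {poly F}) (u : valuation_ring w) i :
  (forall j, vle v 1 p`_j) -> vle v p`_i 1 ->
  ~~ vle w (map_poly c p).[val u] 1 ->
  algebraicOver (residue_map c w (v := v)) (\pi_(residue_field w)%qT u).
Proof.
move=> p1 pi pu; exists (\poly_(j < size p) residue v p`_j).
  apply: contraTneq pi => /polyP/(_ i); rewrite coef_poly coef0.
  case: ltnP => [_ /eqP|/(nth_default 0) -> _]; last by rewrite vle0x oner_eq0.
  by rewrite residue_eq0 maximal_idealE insubdK // -vle1_valring.
have rm0 : residue_map c w (0 : residue_field v) = 0.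
  rewrite -[X in residue_map c w X](residue0 v) residue_map_residue ?vle0 //.
  by rewrite rmorph0 residue0.
apply/rootP; rewrite (@horner_coef_wide _ (size p)); last first.
  exact: leq_trans (size_poly _ _) (size_poly _ _).
pose k j := insubd (0 : valuation_ring w) (c p`_j).
have ck j : val (k j) = c p`_j.
  by rewrite insubdK // -vle1_valring -(rmorph1 c) (vle_ext c_ext).
transitivity (\pi_(residue_field w)%qT (\sum_(j < size p) k j * u ^+ j)).
  rewrite rmorph_sum; apply: eq_bigr => j _.
  rewrite coef_map_id0 // coef_poly ltn_ord residue_map_residue //.
  by rewrite rmorphM rmorphXn.
apply/eqP; rewrite residue_eq0 maximal_idealE rmorph_sum.
congr (~~ vle _ _ _): pu.
rewrite (horner_coef_wide _ (size_poly _ _)); apply: eq_bigr => j _.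
by rewrite coef_map rmorphM rmorphXn /= ck.
Qed.
End ResidueMap.

Lemma vle_sub_exp (F : fieldType) (v : valuation F) x y n :
  vle v 1 x -> vle v 1 y -> vle v (x - y) (x ^+ n - y ^+ n).
Proof.
have exp1 z k : vle v 1 z -> vle v 1 (z ^+ k).
  by move=> z1; rewrite -(expr1n F k) vleXn.
move=> x1 y1; rewrite subrXX -[X in vle v X _]mulr1 vle_mul //.
apply: vle_sum => i _; rewrite -[1]mulr1.
by rewrite vle_mul ?exp1.
Qed.

(** * Transcendence excludes approximation by constants *)

Section FiniteExtensions.
Variables (K : fieldType) (L : closedFieldType) (iota : {rmorphism K -> L}).
Hypothesis L_alg : forall z : L, algebraicOver iota z.
Variables (nu : valuation K) (omega : valuation (ratfun K)).
Hypothesis omega_ext : val_extends (@ratfun_const K) nu omega.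
Variable nubar : valuation L.

Local Notation cL := (@ratfun_const L).
Local Notation emb := (ratfun_map iota).
Local Notation simult := (simultaneous_extension iota omega nubar).

(** An approximating constant e would have the same value as u. As e is algebraic over K, a multiple
    of that value lies in the value group of nu, whereas u is chosen with non-torsion class. *)
Lemma value_transcendental_not_approx : value_transcendental omega ->
  exists2 u, u != 0 & forall mu, simult mu -> ~ const_approx cL mu (emb u).
Proof.
move=> /dim_tensor_rat1_nontorsion[a a_tors].
have [u ua] := val_onto (repr a).
exists u => [|mu [mu_omega mu_nubar] [e ue]].
  by apply/eqP => u0; move: ua; rewrite u0 Defs.val0.
have /andP[_] := const_approx_neq0 ue; rewrite fmorph_eq0 => e0.
have [m m0 [k ek]] := algebraic_val_torsion nubar e0 (L_alg e).
have um : mu (emb (u ^+ m)) = mu (emb (ratfun_const k)).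
  rewrite ratfun_map_const -(val_ext_eq mu_nubar ek) !rmorphXn.
  by apply: val_exp_eq; apply: val_eq_sub.
have omega_um : omega (u ^+ m) = omega (ratfun_const k).
  by move/val_eqP: um => um; apply/val_eqP; rewrite -!(vle_ext mu_omega).
case/negP: (a_tors m m0); rewrite -[a]reprK -raddfMn.
rewrite -[X in _ == X](raddf0
  \pi_(value_group_quotient (@ratfun_const K) omega)%qT).
rewrite -Quotient.idealrBE subr0; apply/asboolP; exists k.
by rewrite -omega_um; apply: val_exp.
Qed.

(** Let u lift the transcendental residue t. If e approximates u and q(e) = 0, then q(u) = q(u) -
    q(e) is an integral multiple of u - e, so it has positive value and t is algebraic. *)
Lemma residue_transcendental_not_approx : residue_transcendental nu omega ->
  exists2 u, u != 0 & forall mu, simult mu -> ~ const_approx cL mu (emb u).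
Proof.
move=> [t [t_trans _]]; pose U := repr t; pose u := val U.
have alg (p : {poly K}) i : (forall j, vle nu 1 p`_j) -> vle nu p`_i 1 ->
    vle omega (map_poly (@ratfun_const K) p).[u] 1.
  move=> p1 pi; apply: contrapT => /negP pu; apply: t_trans.
  by rewrite -[t]reprK; apply: (algebraicOver_residue_map omega_ext p1 pi pu).
exists u => [|mu [mu_omega mu_nubar] [e ue]].
  apply/eqP => u0; have := @alg 'X 1; rewrite coefX vle_refl u0 => /(_ _ isT).
  rewrite map_polyX hornerX vle0x oner_eq0 => H.
  suff: false by []; apply: H => j.
  by rewrite coefX; case: eqP; rewrite ?vle0 ?vle_refl.
have u1 : vle mu 1 (emb u).
  by rewrite -(rmorph1 emb) (vle_ext mu_omega) vle1_valring valring_valP.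
have [e1 _] := andP (introT (val_eqP _ _ _) (val_eq_sub ue)).
have [p p0 /rootP pe] := L_alg e.
have [i0 lei0 mini0] := exists_vle_min nu (fun i => p`_i) (size p).
have pi0 : p`_i0 != 0.
  apply: contraNneq p0 => pi; have := mini0 (size p).-1 (leq_pred _).
  by rewrite pi vle0x -lead_coefE lead_coef_eq0.
(* Dividing by a coefficient of least value makes q integral with a coefficient equal to 1. *)
pose q : {poly K} := (p`_i0)^-1 *: p.
have q1 j : vle nu 1 q`_j.
  rewrite coefZ -(mulVf pi0) vle_mul2l ?invr_eq0 //.
  have [/mini0 //|/ltnW/(nth_default 0)->] := leqP j (size p); exact: vle0.
have qi : vle nu q`_i0 1 by rewrite coefZ mulVf // vle_refl.
have : vle mu (emb (map_poly (@ratfun_const K) q).[u]) 1.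
  by rewrite -(rmorph1 emb) (vle_ext mu_omega) (alg q i0).
have -> : emb (map_poly (@ratfun_const K) q).[u] =
    (map_poly (cL \o iota) q).[emb u] - (map_poly (cL \o iota) q).[cL e].
  have -> : (map_poly (cL \o iota) q).[cL e] = 0.
    rewrite (map_poly_comp cL iota) horner_map map_polyZ hornerZ pe mulr0.
    exact: rmorph0.
  rewrite subr0 -horner_map -(map_poly_comp emb).
  by congr (horner _ _); apply: eq_map_poly => k; rewrite /= ratfun_map_const.
rewrite !horner_coef -sumrB => H; case/negP: ue.
have cq j : vle mu 1 (map_poly (cL \o iota) q)`_j.
  rewrite coef_map /= -ratfun_map_const -(rmorph1 emb) (vle_ext mu_omega).
  by rewrite -(rmorph1 (@ratfun_const K)) (vle_ext omega_ext).
apply: (vle_trans _ u1); apply: vle_trans H; apply: vle_sum => j _.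
rewrite -mulrBr -[X in vle _ X _]mul1r; apply: vle_mul (cq j) _.
exact: vle_sub_exp u1 (vle_trans u1 e1).
Qed.

(** * Uniqueness of a Gauss extension with given data *)

(** Some power of e' / e has the value of a constant k of K. Raised to that power, the comparison
    takes place in K(x), where omega decides it. *)
Lemma vle_monomial_unique mu mu' e e' u u' : simult mu -> simult mu' ->
  vle mu (cL e * emb u) (cL e' * emb u') =
  vle mu' (cL e * emb u) (cL e' * emb u').
Proof.
move=> sm sm'.
have [->|e0] := eqVneq e 0; first by rewrite rmorph0 !mul0r !vle0x.
have [->|e'0] := eqVneq e' 0; first by rewrite rmorph0 !mul0r !vle0.
have x0 : e' / e != 0 by rewrite mulf_neq0 ?invr_eq0.
have [m m0 [k xk]] := algebraic_val_torsion nubar x0 (L_alg _).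
have to_omega rho : simult rho -> vle rho (cL e * emb u) (cL e' * emb u') =
    vle omega (u ^+ m) (ratfun_const k * u' ^+ m).
  move=> [rho_omega rho_nubar].
  have -> : cL e' * emb u' = cL e * (cL (e' / e) * emb u').
    by rewrite mulrA -rmorphM [e * _]mulrC divfK.
  rewrite vle_mul2l ?fmorph_eq0 // -(vle_exp2 _ _ _ m0) [(cL _ * _) ^+ m]exprMn.
  rewrite -[RHS](vle_ext rho_omega) [X in _ = vle _ _ X]rmorphM.
  rewrite /= ratfun_map_const !rmorphXn.
  rewrite /vle; congr ole; apply: val_mul_eq (erefl _).
  by rewrite -rmorphXn; apply: val_ext_eq rho_nubar _ _ xk.
by rewrite !to_omega.
Qed.

(** Each factor is T + (a - z). By [HT] its value is exactly the smaller of those of T and a - z,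
    including when the two are equal. *)
Lemma val_linear_factors mu a (rs : seq L) (T := ('X - a%:P)%:F) :
  (forall r, vle mu (T - cL r) T) ->
  let S z := vle mu T (cL (a - z)) in
  mu (\prod_(z <- rs) ('X - z%:P)%:F) =
  mu (cL (\prod_(z <- rs | ~~ S z) (a - z)) * T ^+ count S rs).
Proof.
move=> HT S; elim: rs => [|z rs IH]; first by rewrite !big_nil rmorph1 mul1r.
rewrite !big_cons /=.
have -> : ('X - z%:P)%:F = T + cL (a - z).
  rewrite /T /ratfun_const /= -rmorphD; congr FracField.tofrac.
  by rewrite polyCB subrKA.
case Sz : (S z) => /=.
  rewrite add1n exprS mulrCA; apply: val_mul_eq IH; apply/val_eqP.
  have := HT (- (a - z)); rewrite rmorphN opprK => -> /=.
  by rewrite vleD ?vle_refl.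
rewrite rmorphM add0n -mulrA; apply: val_mul_eq IH; symmetry; apply: val_eq_sub.
by rewrite opprD addrCA subrr addr0 vleNl; apply: negbT.
Qed.

Lemma ratfun_horner_Xsub a (p : {poly L}) :
  p%:F = (map_poly cL (p \Po ('X + a%:P))).[('X - a%:P)%:F].
Proof.
rewrite horner_ratfun_const -comp_polyA comp_polyD comp_polyX comp_polyC.
by rewrite subrK comp_polyXr.
Qed.

Lemma vle_coef_horner mu T (p : {poly L}) :
  exists i, vle mu (cL p`_i * T ^+ i) (map_poly cL p).[T].
Proof.
have [i _ mini] := exists_vle_min mu (fun i => cL p`_i * T ^+ i) (size p).
exists i; rewrite (horner_coef_wide _ (size_poly _ _)); apply: vle_sum => j _.
by rewrite coef_map /=; apply: mini; apply: ltnW.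
Qed.

(** Under the hypothesis on T the value of a polynomial in T is the least value of its monomials, so
    only comparisons of monomials remain. *)
Lemma vle_hornerP mu T (p q : {poly L}) : (forall r, vle mu (T - cL r) T) ->
  vle mu (map_poly cL p).[T] (map_poly cL q).[T] <->
  forall j, exists i, vle mu (cL p`_i * T ^+ i) (cL q`_j * T ^+ j).
Proof.
move=> /vle_horner_coef HT; split=> [pq j|pq].
  have [i ip] := vle_coef_horner mu T p; exists i.
  exact: vle_trans ip (vle_trans pq (HT _ _)).
have [j jq] := vle_coef_horner mu T q; have [i pi] := pq j.
exact: vle_trans (HT _ _) (vle_trans pi jq).
Qed.

Lemma simult_ext_unique (h : {poly K}) (rs : seq L) a mu mu'
    (T := ('X - a%:P)%:F) :
  h != 0 ->
  map_poly iota h =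
    lead_coef (map_poly iota h) *: \prod_(z <- rs) ('X - z%:P) ->
  a \in rs -> simult mu -> simult mu' ->
  (forall r, vle mu (T - cL r) T) -> (forall r, vle mu' (T - cL r) T) ->
  {in rs, forall z, vle mu T (cL (a - z)) = vle mu' T (cL (a - z))} ->
  val_equiv mu mu'.
Proof.
move=> h0 h_rs a_rs sm sm' HT HT' eqS.
pose S z := vle mu T (cL (a - z)); pose S' z := vle mu' T (cL (a - z)).
pose n := count S rs.
have Sa (rho : valuation (ratfun L)) : vle rho T (cL (a - a)).
  by rewrite subrr rmorph0 vle0.
have n0 : (0 < n)%N.
  by rewrite -has_count; apply/hasP; exists a => //; apply: Sa.
pose l := lead_coef (map_poly iota h).
pose C := l * \prod_(z <- rs | ~~ S z) (a - z).
(* The factor a - a is left out of C, because a itself satisfies S. *)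
have C0 : C != 0.
  rewrite mulf_neq0 ?lead_coef_eq0 ?map_poly_eq0 // prodf_seq_neq0.
  apply/allP => z _; apply/implyP; apply: contra; rewrite subr_eq0 => /eqP <-.
  exact: Sa.
have countE : count S' rs = n by apply: esym; apply: eq_in_count.
have prodE : \prod_(z <- rs | ~~ S' z) (a - z) =
    \prod_(z <- rs | ~~ S z) (a - z).
  rewrite big_seq_cond [RHS]big_seq_cond; apply: eq_bigl => z.
  by case: (boolP (z \in rs)) => // z_rs; rewrite /S /S' (eqS z z_rs).
have emb_h : emb h%:F = cL l * \prod_(z <- rs) ('X - z%:P)%:F.
  by rewrite ratfun_map_tofrac h_rs -mul_polyC rmorphM rmorph_prod.
(* In both extensions h has the value of the same monomial in T, since S and S' agree on the
   roots. *)
have mu_h : mu (emb h%:F) = mu (cL C * T ^+ n).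
  rewrite emb_h rmorphM -mulrA; apply: val_mul_eq (erefl _) _.
  exact: val_linear_factors.
have mu'_h : mu' (emb h%:F) = mu' (cL C * T ^+ n).
  rewrite emb_h rmorphM -mulrA; apply: val_mul_eq (erefl _) _.
  by rewrite -countE -prodE; apply: val_linear_factors.
apply: vle_val_equiv => f g.
have [f1 [f2 [f20 ->]]] := ratfunP f; have [g1 [g2 [g20 ->]]] := ratfunP g.
rewrite !vle_div ?tofrac_eq0 // -!tofracM (ratfun_horner_Xsub a).
rewrite [(g1 * f2)%:F](ratfun_horner_Xsub a).
(* The n-th power replaces T by h, whose value is prescribed by omega; what remains are constants
   times elements of K(x). *)
have monomial b b' i j : vle mu (cL b * T ^+ i) (cL b' * T ^+ j) =
    vle mu' (cL b * T ^+ i) (cL b' * T ^+ j).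
  rewrite (vle_monomial_exp _ _ _ _ C0 n0 mu_h).
  rewrite (vle_monomial_exp _ _ _ _ C0 n0 mu'_h).
  by rewrite -!rmorphXn; apply: vle_monomial_unique.
apply/idP/idP => [/(vle_hornerP _ _ HT) H|/(vle_hornerP _ _ HT') H].
  apply/(vle_hornerP _ _ HT') => j.
  by have [i] := H j; exists i; rewrite -monomial.
apply/(vle_hornerP _ _ HT) => j.
by have [i] := H j; exists i; rewrite monomial.
Qed.

(** * Roots that yield Gauss valuations *)

Lemma const_approx_tofrac mu (p : {poly L}) : p != 0 ->
  (forall z, root p z -> const_approx cL mu ('X - z%:P)%:F) ->
  const_approx cL mu p%:F.
Proof.
move=> p0 H; have [rs p_rs] := closed_field_poly_normal p.
rewrite p_rs -mul_polyC rmorphM rmorph_prod; apply: const_approxM.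
  by apply: const_approx_const; rewrite lead_coef_eq0.
apply: const_approx_prod => z zr; apply: H.
by rewrite p_rs rootZ ?lead_coef_eq0 // root_prod_XsubC.
Qed.

Lemma exists_simult_roots : valuation_transcendental nu omega ->
  exists2 h : {poly K}, h != 0 &
  forall mu, simult mu -> exists2 a, root (map_poly iota h) a &
    forall r, vle mu (('X - a%:P)%:F - cL r) ('X - a%:P)%:F.
Proof.
move=> vt; have [u u0 Hu] : exists2 u, u != 0 &
    forall mu, simult mu -> ~ const_approx cL mu (emb u).
  case: vt; first exact: value_transcendental_not_approx.
  exact: residue_transcendental_not_approx.
have [f [g [g0 uE]]] := ratfunP u.
have f0 : f != 0 by apply: contra_neq u0 => f0; rewrite uE f0 rmorph0 mul0r.
(* The product contains the roots of numerator and denominator of u, and is chosen before mu. *)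
exists (f * g) => [|mu sm]; first exact: mulf_neq0.
apply: contrapT => H; apply: (Hu mu sm).
have root_approx z : root (map_poly iota (f * g)) z ->
    const_approx cL mu ('X - z%:P)%:F.
  move=> rz; apply: contrapT => nz; apply: H; exists z => // r.
  by apply: contrapT => /negP rz'; apply: nz; exists r.
have -> : emb u = (map_poly iota f)%:F / (map_poly iota g)%:F.
  by rewrite uE rmorphM fmorphV /= !ratfun_map_tofrac.
apply: const_approxM; last apply: const_approxV.
all: apply: const_approx_tofrac; rewrite ?map_poly_eq0 // => z rz.
all: by apply: root_approx; rewrite rmorphM rootM rz ?orbT.
Qed.

End FiniteExtensions.

(** * Finiteness by labelling *)

(** Choose one element of A for each label carried in A; every element of A is related to the one
    chosen for any of its labels. *)
Lemma finite_representatives (T : Type) (R : T -> T -> Prop) (A : T -> Prop)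
    (D : finType) (P : T -> D -> Prop) :
  (forall x, A x -> exists d, P x d) ->
  (forall x y d, A x -> A y -> P x d -> P y d -> R x y) ->
  exists (n : nat) (s : 'I_n -> T), forall x, A x -> exists j, R x (s j).
Proof.
move=> AP PR; have [[x0 _]|noA] := pselect (exists x, A x); last first.
  (* With A empty, T may have no element, so the family is indexed by the empty type. *)
  exists 0%N, (fun j : 'I_0 => False_rect T (notF (valP j))) => x Ax.
  by case: noA; exists x.
(* The default [x0] serves the labels that no element of A carries. *)
pose s d :=
  if pselect (exists x, A x /\ P x d) is left ex then projT1 (cid ex) else x0.
exists #|D|, (s \o enum_val) => x Ax; have [d Pd] := AP x Ax.
exists (enum_rank d); rewrite /= enum_rankK /s.
case: pselect => [ex|[]]; last by exists x.
by case: cid => y [Ay Py] /=; apply: PR Pd Py.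
Qed.

Theorem corollary3p13 (K : fieldType) (Kbar : closedFieldType)
    (iota : {rmorphism K -> Kbar})
    (Kbar_alg : forall z : Kbar, algebraicOver iota z)
    (nu : valuation K) (omega : valuation {fraction {poly K}})
    (omega_ext : val_extends (@ratfun_const K) nu omega)
    (omega_vt : valuation_transcendental nu omega)
    (nubar : valuation Kbar) (nubar_ext : val_extends iota nu nubar) :
  exists (n : nat) (s : 'I_n -> valuation {fraction {poly Kbar}}),
    forall mu : valuation {fraction {poly Kbar}},
      simultaneous_extension iota omega nubar mu ->
      exists j : 'I_n, val_equiv mu (s j).
Proof.
have [h h0 H] := exists_simult_roots Kbar_alg omega_ext nubar omega_vt.
have [rs h_rs] := closed_field_poly_normal (map_poly iota h).
pose T (j : 'I_(size rs)) := ('X - (rs`_j)%:P)%:F.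
pose good (mu : valuation (ratfun Kbar)) j :=
  forall r, vle mu (T j - ratfun_const r) (T j).
pose near mu j :=
  [set k : 'I_(size rs) | vle mu (T j) (ratfun_const (rs`_j - rs`_k))].
(* A label consists of the index of a root at which mu is Gauss and the set of indices of the roots
   near it. Indices make the labels a finite type. *)
pose P mu (d : 'I_(size rs) * {set 'I_(size rs)}) :=
  good mu d.1 /\ d.2 = near mu d.1.
apply: (@finite_representatives _ _ (simultaneous_extension iota omega nubar)
  _ P) => [mu /H[a]|mu mu' [j S] sm sm'].
  rewrite h_rs rootZ ?lead_coef_eq0 ?map_poly_eq0 // root_prod_XsubC => a_rs Ha.
  have lt_rs : (index a rs < size rs)%N by rewrite index_mem.
  exists (Ordinal lt_rs, near mu (Ordinal lt_rs)).
  by split=> // r; rewrite /T /= nth_index.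
move=> [gj /= ->] [gj' /= /setP eqS].
apply: (@simult_ext_unique _ _ iota Kbar_alg omega nubar h rs _ mu mu' h0 h_rs
  (mem_nth 0 (ltn_ord j))) => //.
move=> z z_rs; have lt_rs : (index z rs < size rs)%N by rewrite index_mem.
by have := eqS (Ordinal lt_rs); rewrite !inE /= nth_index.
Qed.
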